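(* There is an absolute constant $c>0$ such that, for every integer $n\ge 4$ and every pair of weighted directed graphs $w,u:[n]^{(2)}\to\mathbb R$, $$\mathbb E_\pi\bigl|\langle w_\pi,u\rangle\bigr|\ge c\Bigl(|d(w)d(u)|\,n(n-1)+n^{3/2}J_1(w,u)+n\,J_2(w,u)\Bigr),$$ where $\pi$ is a uniformly random element of $S_n$.
   Context: Write $[n]=\{1,\dots,n\}$ and let $[n]^{(2)}=\{(x,y)\in[n]\times[n]:x\ne y\}$ be the set of ordered pairs of distinct vertices. For weighted directed graphs $w,u:[n]^{(2)}\to\mathbb R$ put $\langle w,u\rangle=\sum_{x\ne y}w_{xy}u_{xy}$, $w([n])=\sum_{x\ne y}w_{xy}$ and $d(w)=w([n])/(n(n-1))$. For $\pi\in S_n$ the relabelling $w_\pi$ is $(w_\pi)_{xy}=w_{\pi^{-1}(x)\pi^{-1}(y)}$. For $x\in[n]$ let $r_x(w)=\sum_{y\ne x}w_{xy}$, $c_x(w)=\sum_{y\ne x}w_{yx}$, and $$p_x(w)=\frac{r_x(w)+c_x(w)}{2(n-2)},\qquad q_x(w)=\frac{r_x(w)-c_x(w)}{2n}.$$ For an ordered pair $a\ne b$ define $$\Phi_1^w(a,b)=\Bigl(\sqrt{\tfrac{2(n-2)}{n}}\,(p_a(w)-p_b(w)),\ \sqrt2\,(q_a(w)-q_b(w))\Bigr)\in\mathbb R^2.$$ For an ordered quadruple $Q=(a,b;c,d)$ of distinct vertices let $C_w(Q)=w_{ac}-w_{bc}-w_{ad}+w_{bd}$, $Q^{\mathsf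 T}=(c,d;a,b)$, and $$\Phi_2^w(Q)=\tfrac12\bigl(C_w(Q)+C_w(Q^{\mathsf T}),\ C_w(Q)-C_w(Q^{\mathsf T})\bigr)\in\mathbb R^2.$$ Define $$J_1(w,u)=\mathbb E\,\bigl|\langle\Phi_1^w(a,b),\Phi_1^u(c,d)\rangle\bigr|,\qquad J_2(w,u)=\mathbb E\,\bigl|\langle\Phi_2^w(Q),\Phi_2^u(Q')\rangle\bigr|,$$ where $\langle\cdot,\cdot\rangle$ is the standard inner product on $\mathbb R^2$; in $J_1$ the ordered pairs $(a,b)$ and $(c,d)$ are chosen independently and uniformly from all ordered pairs of distinct vertices of $[n]$, and in $J_2$ the ordered quadruples $Q,Q'$ are chosen independently and uniformly from all ordered quadruples of distinct vertices of $[n]$. *)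

(* Defs.v *)
From mathcomp Require Import all_boot all_order all_algebra all_fingroup.
From mathcomp Require Import reals exp.

Set Implicit Arguments.
Unset Strict Implicit.
Unset Printing Implicit Defensive.

Import Order.TTheory GRing.Theory Num.Theory.
Local Open Scope ring_scope.

(* The vertex set [n] is 'I_n.  A map from ordered pairs of distinct vertices
   to R is encoded as a total function: diagonal values are never read, since
   every sum and average below ranges over distinct vertices only. *)
Definition wdigraph (R : realType) (n : nat) : Type := 'I_n -> 'I_n -> R.

(* Expectation under the uniform distribution on A. *)
Definition unif_mean (R : realType) (T : finType) (A : {set T}) (f : T -> R)
  : R := (\sum_(t in A) f t) / #|A|%:R.

Definition dot2 (R : realType) (p q : R * R) : R := p.1 * q.1 + p.2 * q.2.

Definition inner (R : realType) (n : nat) (w u : wdigraph R n) : R :=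
  \sum_x \sum_(y | x != y) w x y * u x y.

Definition total_weight (R : realType) (n : nat) (w : wdigraph R n) : R :=
  \sum_x \sum_(y | x != y) w x y.

Definition density (R : realType) (n : nat) (w : wdigraph R n) : R :=
  total_weight w / (n%:R * (n%:R - 1)).

Definition relabel (R : realType) (n : nat) (s : 'S_n) (w : wdigraph R n)
  : wdigraph R n := fun x y => w ((s^-1)%g x) ((s^-1)%g y).

Definition outdeg (R : realType) (n : nat) (w : wdigraph R n) (x : 'I_n) : R :=
  \sum_(y | y != x) w x y.

Definition indeg (R : realType) (n : nat) (w : wdigraph R n) (x : 'I_n) : R :=
  \sum_(y | y != x) w y x.

Definition pdeg (R : realType) (n : nat) (w : wdigraph R n) (x : 'I_n) : R :=
  (outdeg w x + indeg w x) / (2 * (n%:R - 2)).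

Definition qdeg (R : realType) (n : nat) (w : wdigraph R n) (x : 'I_n) : R :=
  (outdeg w x - indeg w x) / (2 * n%:R).

Definition Phi1 (R : realType) (n : nat) (w : wdigraph R n)
    (e : 'I_n * 'I_n) : R * R :=
  (Num.sqrt (2 * (n%:R - 2) / n%:R) * (pdeg w e.1 - pdeg w e.2),
   Num.sqrt 2 * (qdeg w e.1 - qdeg w e.2)).

(* The quadruple (a, b; c, d) is ((a, b), (c, d)). *)
Definition quad (n : nat) : finType := (('I_n * 'I_n) * ('I_n * 'I_n))%type.

Definition quadT (n : nat) (Q : quad n) : quad n := (Q.2, Q.1).

Definition Cw (R : realType) (n : nat) (w : wdigraph R n) (Q : quad n) : R :=
  let: ((a, b), (c, d)) := Q in w a c - w b c - w a d + w b d.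

Definition Phi2 (R : realType) (n : nat) (w : wdigraph R n) (Q : quad n)
  : R * R :=
  (2^-1 * (Cw w Q + Cw w (quadT Q)), 2^-1 * (Cw w Q - Cw w (quadT Q))).

Definition distinct_pairs (n : nat) : {set 'I_n * 'I_n} :=
  [set e | e.1 != e.2].

Definition distinct_quads (n : nat) : {set quad n} :=
  [set Q : quad n | uniq [:: Q.1.1; Q.1.2; Q.2.1; Q.2.2]].

(* Two independent uniform draws from A are one uniform draw from A x A. *)
Definition J1 (R : realType) (n : nat) (w u : wdigraph R n) : R :=
  unif_mean (setX (distinct_pairs n) (distinct_pairs n))
    (fun z => `|dot2 (Phi1 w z.1) (Phi1 u z.2)|).

Definition J2 (R : realType) (n : nat) (w u : wdigraph R n) : R :=
  unif_mean (setX (distinct_quads n) (distinct_quads n))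
    (fun z => `|dot2 (Phi2 w z.1) (Phi2 u z.2)|).

(* Main.v *)
(* Let f s = <w_s, u>.  Three lower bounds for E|f| are added up.
   The density term is |E f|.
   For the others fix k = n/4 disjoint pairs of vertices, and precompose s with
   the random permutation that exchanges the i-th pair when the sign e_i says
   so.  Each summand w_xy u_(s x)(s y) depends on at most two of the signs, so
   the odd part of f in e is a Rademacher sum, and Khinchine's inequality bounds
   E|f| below by k^(-1/2) times the sum of the absolute linear coefficients.
   These are bounded below by testing against functions of s that change sign
   under the i-th exchange.  Testing with functions of the images c, d of a pair
   a, b gives n <Phi1 w (a, b), Phi1 u (c, d)> / 2 plus a residual term that
   averages to zero over b, whence J1.
   Using two disjoint families of k pairs and Khinchine twice, the bilinear
   coefficients are <Phi2 w Q, Phi2 u (s Q)> / 2, whence J2. *)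
Require Import Defs.
From mathcomp Require Import all_boot all_order all_algebra all_fingroup.
From mathcomp Require Import reals exp.
From mathcomp Require Import ring lra zify.

Set Implicit Arguments.
Unset Strict Implicit.
Unset Printing Implicit Defensive.

Import Order.TTheory GRing.Theory Num.Theory.
Local Open Scope ring_scope.

(** * Uniform means over finite sets *)

Section UnifMean.
Variables (R : realType) (T : finType) (A : {set T}).
Implicit Types f g : T -> R.

Lemma eq_unif_mean f g : {in A, f =1 g} -> unif_mean A f = unif_mean A g.
Proof. by move=> fg; rewrite /unif_mean (eq_bigr _ fg). Qed.

Lemma unif_mean_sum (I : finType) (F : I -> T -> R) :
  unif_mean A (fun t => \sum_i F i t) = \sum_i unif_mean A (F i).
Proof. by rewrite /unif_mean exchange_big mulr_suml. Qed.

Lemma unif_meanZ c f : unif_mean A (fun t => c * f t) = c * unif_mean A f.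
Proof. by rewrite /unif_mean -mulr_sumr mulrA. Qed.

Lemma unif_meanD f g :
  unif_mean A (fun t => f t + g t) = unif_mean A f + unif_mean A g.
Proof. by rewrite /unif_mean big_split mulrDl. Qed.

Lemma unif_meanB f g :
  unif_mean A (fun t => f t - g t) = unif_mean A f - unif_mean A g.
Proof. by rewrite /unif_mean sumrB mulrBl. Qed.

Lemma ler_unif_mean f g :
  {in A, forall t, f t <= g t} -> unif_mean A f <= unif_mean A g.
Proof.
by move=> fg; rewrite ler_wpM2r ?invr_ge0 ?ler0n// ler_sum.
Qed.

Lemma ler_norm_unif_mean f :
  `|unif_mean A f| <= unif_mean A (fun t => `|f t|).
Proof.
rewrite normrM [X in _ * X]ger0_norm ?invr_ge0 ?ler0n//.
by rewrite ler_wpM2r ?invr_ge0 ?ler0n// ler_norm_sum.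
Qed.

Lemma unif_mean_cst (c : R) : A != set0 -> unif_mean A (fun=> c) = c :> R.
Proof.
move=> A0; rewrite /unif_mean sumr_const -[c *+ _]mulr_natr mulfK//.
by rewrite pnatr_eq0 cards_eq0.
Qed.

Lemma unif_mean_reindex (h : T -> T) f : injective h ->
  (forall t, (h t \in A) = (t \in A)) ->
  unif_mean A (fun t => f (h t)) = unif_mean A f.
Proof.
move=> hI hA; rewrite /unif_mean [in RHS](reindex_inj hI)/=.
by under [in RHS]eq_bigl do rewrite hA.
Qed.

End UnifMean.

Lemma unif_mean_exchange (R : realType) (T U : finType) (A : {set T})
    (B : {set U}) (f : T -> U -> R) :
  unif_mean A (fun t => unif_mean B (f t)) =
  unif_mean B (fun u => unif_mean A (f^~ u)).
Proof.
rewrite /unif_mean -!mulr_suml exchange_big/= -!mulrA; congr (_ * _).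
exact: mulrC.
Qed.

Lemma unif_mean_setX (R : realType) (T U : finType) (A : {set T})
    (B : {set U}) (f : T * U -> R) :
  unif_mean (setX A B) f =
  unif_mean A (fun t => unif_mean B (fun u => f (t, u))).
Proof.
rewrite /unif_mean -mulr_suml cardsX natrM invfM (mulrC #|A|%:R^-1) mulrA.
congr (_ * _ * _); rewrite pair_big_dep/=; apply: eq_big => -[t u]//=.
by rewrite in_setX.
Qed.

Local Notation mean := (unif_mean [set: _]).

Lemma mean_reindex (R : realType) (T : finType) (h : T -> T) (f : T -> R) :
  injective h -> mean (fun t => f (h t)) = mean f.
Proof. by move=> hI; apply: unif_mean_reindex => // t; rewrite !inE. Qed.

Lemma mean_cst (R : realType) (T : finType) (t : T) (c : R) :
  mean (fun _ : T => c) = c.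
Proof. by apply: (@unif_mean_cst R T); apply/set0Pn; exists t. Qed.

(** * Rademacher sums *)

Section Cube.
Variables (R : realType) (k : nat).
Local Notation cube := {ffun 'I_k -> bool}.
Implicit Types (e : cube) (i j : 'I_k) (a : 'I_k -> R).

Definition sign i e : R := (-1) ^+ e i.

Definition flip1 i e : cube := [ffun j => e j (+) (j == i)].
Definition flipall e : cube := [ffun j => ~~ e j].

Lemma flip1_inj i : injective (flip1 i).
Proof.
apply: inv_inj => e; apply/ffunP => j; rewrite !ffunE.
by rewrite -addbA addbb addbF.
Qed.

Lemma flipall_inj : injective flipall.
Proof. by apply: inv_inj => e; apply/ffunP => j; rewrite !ffunE negbK. Qed.

Lemma sign_flip1 i j e : sign j (flip1 i e) = (-1) ^+ (j == i) * sign j e.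
Proof. by rewrite /sign ffunE signr_addb mulrC. Qed.

Lemma sign_flipall j e : sign j (flipall e) = - sign j e.
Proof. by rewrite /sign ffunE signrN. Qed.

Lemma sign_sqr j e : sign j e * sign j e = 1.
Proof. by rewrite -expr2 sqrr_sign. Qed.

Lemma mean_sign0 i (g : cube -> R) : (forall e, g (flip1 i e) = g e) ->
  mean (fun e => sign i e * g e) = 0.
Proof.
move=> gE; set m := unif_mean _ _; suff: m = - m by move=> ?; lra.
rewrite {1}/m -(mean_reindex _ (@flip1_inj i)) -mulN1r -unif_meanZ.
by apply: eq_unif_mean => e _; rewrite gE sign_flip1 eqxx mulrA.
Qed.

Lemma mean_sign_prod i j :
  mean (fun e => sign i e * sign j e) = (i == j)%:R :> R.
Proof.
have [<-|ij] := eqVneq i j.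
  by under eq_unif_mean do rewrite sign_sqr; rewrite mean_cst//; exact: [ffun=> true].
by apply: mean_sign0 => e; rewrite sign_flip1 eq_sym (negPf ij) mul1r.
Qed.

(** Induction adds one sign at a time: odd powers of the new sign average to zero, because the
    remaining sum does not involve it. The fourth moment then needs a^4 + 6 a^2 V + 3 V^2 <= 3 (a^2
    + V)^2. *)
Lemma rademacher_moments a (s : seq 'I_k) : uniq s ->
  let X e := \sum_(i <- s) a i * sign i e in
  let V := \sum_(i <- s) a i ^+ 2 in
  mean (fun e => X e ^+ 2) = V /\ mean (fun e => X e ^+ 4) <= 3 * V ^+ 2.
Proof.
have e0 : cube := [ffun=> true].
elim: s => [_|i s IH /= /andP[ins us]].
  rewrite /= !big_nil; split.
    by under eq_unif_mean do rewrite big_nil expr0n/=; rewrite mean_cst.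
  by under eq_unif_mean do rewrite big_nil expr0n/=; rewrite mean_cst//; lra.
pose X e := \sum_(j <- s) a j * sign j e; pose V := \sum_(j <- s) a j ^+ 2.
have [m2 m4] : mean (fun e => X e ^+ 2) = V /\ mean (fun e => X e ^+ 4) <= 3 * V ^+ 2.
  exact: IH.
have XE e : X (flip1 i e) = X e.
  rewrite /X !big_seq; apply: eq_bigr => j js; rewrite sign_flip1.
  by case: eqP js ins => [->->//|]; rewrite mul1r.
have z1 m : mean (fun e => sign i e * X e ^+ m) = 0.
  by apply: mean_sign0 => e; rewrite XE.
have V0 : 0 <= V by apply: sumr_ge0 => j _; exact: sqr_ge0.
rewrite big_cons -/V; split.
  under eq_unif_mean => e _.
    rewrite big_cons -/(X e).
    rewrite (_ : _ ^+ 2 = a i ^+ 2 + (2 * a i) * (sign i e * X e ^+ 1) + X e ^+ 2);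
      last by rewrite sqrrD exprMn (expr2 (sign i e)) sign_sqr; ring.
    over.
  by rewrite !unif_meanD unif_meanZ z1 m2 mean_cst// mulr0 addr0.
under eq_unif_mean => e _.
  rewrite big_cons -/(X e).
  rewrite (_ : _ ^+ 4 = a i ^+ 4 + (4 * a i ^+ 3) * (sign i e * X e ^+ 1) +
      (6 * a i ^+ 2) * X e ^+ 2 + (4 * a i) * (sign i e * X e ^+ 3) + X e ^+ 4);
    last first.
    have := sign_sqr i e; set t := sign i e => tt; rewrite -[in RHS](mulr1 (4 * _)).
    have t3 : t ^+ 3 = t by rewrite !exprS expr0 mulr1 tt mulr1.
    have t4 : t ^+ 4 = 1 by rewrite !exprS expr0 mulr1 tt mulr1 tt.
    have t2 : t ^+ 2 = 1 by rewrite expr2.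
    rewrite (_ : (a i * t + X e) ^+ 4 = a i ^+ 4 * t ^+ 4 + 4 * a i ^+ 3 * t ^+ 3 * X e
      + 6 * a i ^+ 2 * t ^+ 2 * X e ^+ 2 + 4 * a i * t * X e ^+ 3 + X e ^+ 4); last ring.
    by rewrite t4 t3 t2; ring.
  over.
rewrite !unif_meanD !unif_meanZ !z1 m2 mean_cst// !mulr0 !addr0.
have := sqr_ge0 (a i); nra.
Qed.

(* [y >= y^2 - 4/27 y^4] for [y >= 0], applied to [y = |X| / s] with [s] the
   standard deviation of [X], reduces the L1 bound to the fourth moment. *)
Lemma khinchine_l1 a :
  Num.sqrt (\sum_i a i ^+ 2) <= 2 * mean (fun e => `|\sum_i a i * sign i e|).
Proof.
have := rademacher_moments a (index_enum_uniq 'I_k).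
cbv zeta; set V := \sum_i a i ^+ 2 => -[m2 m4].
set X := fun e => \sum_i a i * sign i e.
have V0 : 0 <= V by apply: sumr_ge0 => j _; exact: sqr_ge0.
set s := Num.sqrt V.
have s2 : s ^+ 2 = V by rewrite sqr_sqrtr.
have [s0|sn0] := eqVneq s 0.
  rewrite s0 mulr_ge0//; apply: le_trans (ler_norm_unif_mean _ _).
  exact: normr_ge0.
have sp : 0 < s by rewrite lt_neqAle eq_sym sn0 sqrtr_ge0.
have pw e : s ^+ 2 * X e ^+ 2 - 4 / 27 * X e ^+ 4 <= s ^+ 3 * `|X e|.
  have: X e ^+ 2 = `|X e| ^+ 2 by rewrite real_normK ?num_real.
  rewrite (_ : X e ^+ 4 = (X e ^+ 2) ^+ 2); last by rewrite -exprM.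
  move=> ->; move: (normr_ge0 (X e)); move: `|X e| => y y0.
  (* The constant 4/27 is the one for which s^3 y - s^2 y^2 + 4/27 y^4 has a double root, at y =
     3s/2. *)
  have h : 0 <= y * (y + 3 * s) * (y - 3 / 2 * s) ^+ 2.
    by rewrite mulr_ge0 ?sqr_ge0// mulr_ge0// addr_ge0// mulr_ge0// ltW.
  have -> : s ^+ 3 * y = s ^+ 2 * y ^+ 2 - 4 / 27 * (y ^+ 2) ^+ 2 +
    4 / 27 * (y * (y + 3 * s) * (y - 3 / 2 * s) ^+ 2) by field.
  by rewrite lerDl mulr_ge0//; lra.
have : mean (fun e => s ^+ 2 * X e ^+ 2 - 4 / 27 * X e ^+ 4) <=
       mean (fun e => s ^+ 3 * `|X e|) by apply: ler_unif_mean => e _.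
rewrite unif_meanB !unif_meanZ m2 -s2.
move: m4; rewrite -s2; set m := mean _; set l := mean _ => m4 h.
(* The fourth moment costs at most 3 * 4/27 = 4/9 of s^4. This leaves 5/9, more than the half that
   is claimed. *)
have h2 : s ^+ 3 * (5 / 9 * s) <= s ^+ 3 * l.
  apply: le_trans h; rewrite -/l -/m.
  have -> : s ^+ 3 * (5 / 9 * s) = s ^+ 2 * s ^+ 2 - 4 / 27 * (3 * (s ^+ 2) ^+ 2) by field.
  by rewrite lerD2l lerN2 ler_pM2l//; lra.
by move: h2; rewrite ler_pM2l ?exprn_gt0//; lra.
Qed.

(** Cauchy-Schwarz, by expanding the nonnegative double sum of the squares of |a_i| - |a_j|. *)
Lemma sum_norm_le_sqrt a :
  \sum_i `|a i| <= Num.sqrt k%:R * Num.sqrt (\sum_i a i ^+ 2).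
Proof.
rewrite -sqrtrM ?ler0n// -[leLHS]ger0_norm ?sumr_ge0//.
rewrite -sqrtr_sqr ler_wsqrtr//.
have h : 0 <= \sum_(i < k) \sum_(j < k) (`|a i| - `|a j|) ^+ 2.
  by apply: sumr_ge0 => i _; apply: sumr_ge0 => j _; exact: sqr_ge0.
set V := \sum_i a i ^+ 2; set S : R := \sum_i `|a i|.
have e2 i : `|a i| ^+ 2 = a i ^+ 2 by rewrite real_normK ?num_real.
have : \sum_(i < k) \sum_(j < k) (`|a i| - `|a j|) ^+ 2 = 2 * (k%:R * V - S ^+ 2).
  transitivity (\sum_(i < k) (k%:R * a i ^+ 2 - 2 * S * `|a i| + V)).
    apply: eq_bigr => i _.
    under eq_bigr do rewrite sqrrB !e2.
    rewrite big_split sumrB/= sumr_const card_ord; congr (_ - _ + _).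
      by rewrite mulr_natl.
    by rewrite sumrMnl -mulr_sumr -/S -[LHS]mulr_natl; ring.
  rewrite big_split sumrB/= sumr_const card_ord -!mulr_sumr -/V -/S -[V *+ _]mulr_natl.
  ring.
by move: h => /[swap] ->; lra.
Qed.

(** The left side is twice the odd part of [phi] under the global sign change. That part must have
    degree one in the signs, while the even part is arbitrary. *)
Definition odd_linear (phi : cube -> R) :=
  exists c : 'I_k -> R, forall e,
    phi e - phi (flipall e) = 2 * \sum_i c i * sign i e.

Lemma eq_odd_linear (psi phi : cube -> R) :
  phi =1 psi -> odd_linear psi -> odd_linear phi.
Proof. by move=> E [c cE]; exists c => e; rewrite !E. Qed.

Lemma odd_linear_sum (I : finType) (c : I -> R) (F : I -> cube -> R) :
  (forall x, odd_linear (F x)) -> odd_linear (fun e => \sum_x c x * F x e).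
Proof.
move=> /fin_all_exists[C CE].
exists (fun i => \sum_x c x * C x i) => e; rewrite -sumrB.
under eq_bigr do rewrite -mulrBr CE mulrCA.
rewrite -mulr_sumr; congr (_ * _).
under eq_bigr do rewrite mulr_sumr.
rewrite exchange_big; apply: eq_bigr => i _; rewrite mulr_suml.
by apply: eq_bigr => x _; rewrite mulrA.
Qed.

(** The product of two signs is even, so only linear terms survive in the odd part. Equal signs
    determine [c1] and opposite signs [c2]; when i = j the two coefficients add up to 2 [c1], as
    they should. *)
Lemma odd_linear2 i j (g : bool -> bool -> R) :
  odd_linear (fun e => g (e i) (e j)).
Proof.
pose c1 := (g false false - g true true) / 4.
pose c2 := (g false true - g true false) / 4.
exists (fun l => (l == i)%:R * (c1 + c2) + (l == j)%:R * (c1 - c2)) => e.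
under eq_bigr do rewrite mulrDl.
rewrite big_split/= (bigD1 i)//= big1 ?addr0; last first.
  by move=> l /negPf ->; rewrite !mul0r.
rewrite (bigD1 j)//= big1 ?addr0; last by move=> l /negPf ->; rewrite !mul0r.
rewrite !eqxx !mul1r /sign !ffunE /c1 /c2.
by case: (e i) (e j) => -[]/=; rewrite ?expr0 ?expr1; field.
Qed.

(** The even part of [phi] is orthogonal to every sign, so these correlations are the coefficients
    of the odd part. Cauchy-Schwarz bounds them by their l2 norm and Khinchine bounds that by the L1
    norm of the odd part, which is at most that of [phi]. *)
Lemma odd_linear_l1 (phi : cube -> R) : odd_linear phi ->
  \sum_i `|mean (fun e => sign i e * phi e)| <=
  2 * Num.sqrt k%:R * mean (fun e => `|phi e|).
Proof.
case=> c cE.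
have flipm g : mean (fun e => g (flipall e)) = mean g :> R.
  exact: (mean_reindex g flipall_inj).
have coef i : mean (fun e => sign i e * phi e) = c i.
  have -> : mean (fun e => sign i e * phi e) =
      2^-1 * mean (fun e => sign i e * (phi e - phi (flipall e))).
    under [in RHS]eq_unif_mean do rewrite mulrBr.
    rewrite unif_meanB.
    have := flipm (fun e => sign i e * phi e).
    under eq_unif_mean do rewrite sign_flipall mulNr -mulN1r.
    by rewrite unif_meanZ; lra.
  under eq_unif_mean => e _ do rewrite cE mulrCA.
  rewrite unif_meanZ mulrA mulVf ?mul1r ?pnatr_eq0//.
  under eq_unif_mean => e _.
    rewrite mulr_sumr; under eq_bigr do rewrite mulrCA.
    over.
  rewrite unif_mean_sum (bigD1 i)//= big1 ?addr0; last first.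
    by move=> j ji; rewrite unif_meanZ mean_sign_prod eq_sym (negPf ji) mulr0.
  by rewrite unif_meanZ mean_sign_prod eqxx mulr1.
under eq_bigr do rewrite coef.
apply: le_trans (sum_norm_le_sqrt c) _.
rewrite mulrC [2 * _]mulrC -[leRHS]mulrA [leRHS]mulrC -subr_ge0 -mulrBl.
rewrite mulr_ge0 ?sqrtr_ge0// subr_ge0.
apply: le_trans (khinchine_l1 c) _; rewrite ler_pM2l//.
have -> : mean (fun e => `|phi e|) =
    mean (fun e => 2^-1 * (`|phi e| + `|phi (flipall e)|)).
  by rewrite unif_meanZ unif_meanD (flipm (fun e => `|phi e|)); lra.
apply: ler_unif_mean => e _.
have -> : \sum_i c i * sign i e = 2^-1 * (phi e - phi (flipall e)).
  by rewrite cE mulrA mulVf ?mul1r ?pnatr_eq0.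
by rewrite normrM ger0_norm ?invr_ge0// ler_pM2l ?invr_gt0// ler_normB.
Qed.

End Cube.

(** * Images of distinct vertices under a uniform random permutation *)

Section PermMean.
Variables (R : realType) (n : nat).
Implicit Types (f : 'S_n -> R) (r s : 'S_n).

Lemma mean_mulgl r f : mean (fun s => f (r * s)%g) = mean f.
Proof. exact: mean_reindex (mulgI r). Qed.

(** By transitivity and translation invariance the left side does not depend on the point z of A.
    Averaging it over z and exchanging the two means gives the claim, since each [act s] permutes
    A. *)
Lemma mean_orbit (T : finType) (A : {set T}) (act : 'S_n -> T -> T) z
    (g : T -> R) :
  (forall s, injective (act s)) ->
  (forall s t, (act s t \in A) = (t \in A)) ->
  (forall r s t, act (r * s)%g t = act s (act r t)) ->
  {in A &, forall t t', exists s, act s t = t'} ->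
  z \in A -> mean (fun s => g (act s z)) = unif_mean A g.
Proof.
move=> actI actA actM tr zA.
have indep t : t \in A -> mean (fun s => g (act s t)) = mean (fun s => g (act s z)).
  move=> tA; have [r <-] := tr z t zA tA.
  rewrite -[RHS](mean_mulgl r (fun s => g (act s z))).
  by apply: eq_unif_mean => s _; rewrite actM.
have A0 : A != set0 by apply/set0Pn; exists z.
rewrite -[LHS](unif_mean_cst _ A0) -(eq_unif_mean indep) unif_mean_exchange.
under eq_unif_mean => s _ do rewrite (unif_mean_reindex g (actI s) (actA s)).
by rewrite (mean_cst (1%g : 'S_n)).
Qed.

(** After the tails are matched, one transposition corrects the image of the head; it leaves the
    images of the tail alone because the entries are distinct. *)
Lemma uniq_map_perm (a b : seq 'I_n) : uniq a -> uniq b -> size a = size b ->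
  exists s : 'S_n, map s a = b.
Proof.
elim: a b => [|x a IH] [|y b]//=; first by exists 1%g.
move=> /andP[xa ua] /andP[yb ub] [/IH] /(_ ua ub)[s sab].
exists (s * tperm (s x) y)%g; rewrite permM tpermL -{}sab in yb *; congr (_ :: _).
apply/eq_in_map => z za; rewrite permM tpermD//.
  by rewrite (inj_eq perm_inj); apply: contraNneq xa => ->.
by apply: contraNneq yb => ->; exact: map_f.
Qed.

Lemma mean_pair (a b : 'I_n) (g : 'I_n -> 'I_n -> R) : a != b ->
  mean (fun s : 'S_n => g (s a) (s b)) =
  unif_mean (distinct_pairs n) (fun e => g e.1 e.2).
Proof.
move=> ab; pose act (s : 'S_n) (e : 'I_n * 'I_n) := (s e.1, s e.2).
apply: (@mean_orbit _ _ act (a, b) (fun e => g e.1 e.2)).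
- by move=> s [x y] [x' y'] [/perm_inj -> /perm_inj ->].
- by move=> s [x y]; rewrite !inE/= (inj_eq perm_inj).
- by move=> r s [x y]; rewrite /act/= !permM.
- move=> [x y] [x' y']; rewrite !inE/= => xy xy'.
  have [|||s [sx sy]] := @uniq_map_perm [:: x; y] [:: x'; y'] => //=.
  + by rewrite inE xy.
  + by rewrite inE xy'.
  by exists s; rewrite /act/= sx sy.
- by rewrite inE.
Qed.

Lemma mean_quad (a b c d : 'I_n) (g : quad n -> R) : uniq [:: a; b; c; d] ->
  mean (fun s : 'S_n => g ((s a, s b), (s c, s d))) =
  unif_mean (distinct_quads n) g.
Proof.
move=> abcd.
pose act (s : 'S_n) (Q : quad n) : quad n :=
  ((s Q.1.1, s Q.1.2), (s Q.2.1, s Q.2.2)).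
apply: (@mean_orbit _ _ act ((a, b), (c, d)) g).
- move=> s [[x y] [z t]] [[x' y'] [z' t']].
  by move=> [/perm_inj -> /perm_inj -> /perm_inj -> /perm_inj ->].
- move=> s [[x y] [z t]]; rewrite !inE/=.
  exact: (map_inj_uniq (@perm_inj _ s) [:: x; y; z; t]).
- by move=> r s [[x y] [z t]]; rewrite /act/= !permM.
- move=> [[x y] [z t]] [[x' y'] [z' t']]; rewrite !in_set => u1 u2.
  have [//|s [sx sy sz st]] := uniq_map_perm u1 u2.
  by exists s; rewrite /act/= sx sy sz st.
- by rewrite in_set.
Qed.

End PermMean.

(** * Permutations exchanging disjoint pairs *)

Lemma inner_relabel (R : realType) (n : nat) (w u : wdigraph R n) (s : 'S_n) :
  inner (relabel s w) u = \sum_x \sum_(y | x != y) w x y * u (s x) (s y).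
Proof.
rewrite /inner (reindex_inj (@perm_inj _ s))/=; apply: eq_bigr => x _.
rewrite (reindex_inj (@perm_inj _ s))/=; apply: eq_big => [y|y _].
  by rewrite (inj_eq perm_inj).
by rewrite /relabel !permK.
Qed.

(** This invariance allows [w] to be relabelled at random later on, which turns fixed pairs of
    vertices into uniform ones. *)
Lemma mean_inner_relabel (R : realType) (n : nat) (w u : wdigraph R n)
    (r : 'S_n) :
  mean (fun s => `|inner (relabel s (relabel r w)) u|) =
  mean (fun s => `|inner (relabel s w) u|).
Proof.
rewrite -[RHS](mean_mulgl r); apply: eq_unif_mean => s _; congr (`|_|).
apply: eq_bigr => x _; apply: eq_bigr => y _.
by rewrite /relabel invMg !permM.
Qed.

(** * Linear coefficients in the signs, bounded below by test functions *)

Section TestFunctions.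
Variables (R : realType) (n k : nat).
Local Notation cube := {ffun 'I_k -> bool}.
Implicit Types (f th : 'S_n -> R) (T : cube -> 'S_n).

(** In [T e * s] the factor [T e] acts first: the exchanges are applied to the vertices before
    [s]. *)
Definition swap_coef T (i : 'I_k) f (s : 'S_n) : R :=
  mean (fun e => sign R i e * f (T e * s)%g).

(** Left translation by [T e] preserves the mean over [s], so the L1 norm of [f] is also a mean over
    the cube, and [odd_linear_l1] applies for each [s]. *)
Lemma sum_swap_coef_le T f :
  (forall s, odd_linear (fun e => f (T e * s)%g)) ->
  \sum_i mean (fun s => `|swap_coef T i f s|) <=
  2 * Num.sqrt k%:R * mean (fun s => `|f s|).
Proof.
move=> lin; rewrite -unif_mean_sum.
have -> : mean (fun s => `|f s|) = mean (fun s => mean (fun e => `|f (T e * s)%g|)).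
  rewrite [RHS]unif_mean_exchange.
  under [RHS]eq_unif_mean => e _.
    rewrite (mean_mulgl (T e) (fun s => `|f s|)).
    over.
  by rewrite (mean_cst ([ffun=> true] : cube)).
rewrite -unif_meanZ; apply: ler_unif_mean => s _.
exact: odd_linear_l1.
Qed.

(** The sign in the coefficient is absorbed by the sign change of [th]; translation by [T e] then
    removes [e]. *)
Lemma mean_swap_coef T i f th :
  (forall e s, th (T e * s)%g = sign R i e * th s) ->
  mean (fun s => th s * swap_coef T i f s) = mean (fun s => th s * f s).
Proof.
move=> thT.
under eq_unif_mean => s _ do rewrite -unif_meanZ.
rewrite unif_mean_exchange.
under eq_unif_mean => e _.
  under eq_unif_mean => s _ do rewrite mulrA (mulrC (th s)) -thT.
  rewrite (mean_mulgl (T e) (fun s => th s * f s)).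
  over.
by rewrite (mean_cst ([ffun=> true] : cube)).
Qed.

Lemma ler_mean_test f th : (forall s, `|th s| <= 1) ->
  mean (fun s => th s * f s) <= mean (fun s => `|f s|).
Proof.
move=> th1; apply: ler_unif_mean => s _.
by rewrite (le_trans (ler_norm _))// normrM ler_piMl.
Qed.

Lemma swap_test1 T f (th : 'I_k -> 'S_n -> R) :
  (forall s, odd_linear (fun e => f (T e * s)%g)) ->
  (forall i s, `|th i s| <= 1) ->
  (forall i e s, th i (T e * s)%g = sign R i e * th i s) ->
  \sum_i mean (fun s => th i s * f s) <=
  2 * Num.sqrt k%:R * mean (fun s => `|f s|).
Proof.
move=> lin th1 thT; apply: le_trans (sum_swap_coef_le lin).
apply: ler_sum => i _; rewrite -(mean_swap_coef f (thT i)).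
exact: ler_mean_test.
Qed.

(** Khinchine is used over [T1] for [f], then over [T2] for each coefficient [swap_coef T1 i f], and
    the two factors 2 sqrt(k) multiply to 4k. That coefficient averages over [T1 e], which is the
    value taken by [r] in the second linearity hypothesis. *)
Lemma swap_test2 T1 T2 f (th : 'I_k -> 'I_k -> 'S_n -> R) :
  (forall s, odd_linear (fun e => f (T1 e * s)%g)) ->
  (forall r s, odd_linear (fun e => f (r * T2 e * s)%g)) ->
  (forall i j s, `|th i j s| <= 1) ->
  (forall i j e s, th i j (T1 e * s)%g = sign R i e * th i j s) ->
  (forall i j e s, th i j (T2 e * s)%g = sign R j e * th i j s) ->
  \sum_i \sum_j mean (fun s => th i j s * f s) <=
  4 * k%:R * mean (fun s => `|f s|).
Proof.
move=> lin1 lin2 th1 thT1 thT2.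
have -> : 4 * k%:R = 2 * Num.sqrt k%:R * (2 * Num.sqrt k%:R) :> R.
  by rewrite mulrACA -(expr2 (Num.sqrt _)) sqr_sqrtr ?ler0n//; ring.
rewrite -[leRHS]mulrA; apply: (@le_trans _ _ (2 * Num.sqrt k%:R *
    \sum_i mean (fun s => `|swap_coef T1 i f s|))); last first.
  by rewrite ler_wpM2l ?mulr_ge0 ?sqrtr_ge0//; exact: sum_swap_coef_le.
rewrite mulr_sumr; apply: ler_sum => i _.
rewrite (eq_bigr (fun j => mean (fun s => th i j s * swap_coef T1 i f s))).
  apply: swap_test1 => // s; rewrite /swap_coef /unif_mean.
  pose c (e : cube) := sign R i e / #|[set: cube]|%:R.
  apply: (@eq_odd_linear _ _ (fun d => \sum_e c e * f (T1 e * T2 d * s)%g)).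
    move=> d; rewrite mulr_suml; apply: eq_big => [e|e _]; first by rewrite inE.
    by rewrite mulgA /c mulrAC.
  by apply: odd_linear_sum => e; exact: lin2.
by move=> j _; rewrite mean_swap_coef.
Qed.

End TestFunctions.

(** * Construction of the exchanging permutations *)

Section Swaps.
Variables (n k : nat) (v : 'I_k * bool -> 'I_n).
Hypothesis v_inj : injective v.
Local Notation cube := {ffun 'I_k -> bool}.
Implicit Types (e : cube) (p : 'I_k * bool) (x : 'I_n).

Definition swap_fun e x :=
  if [pick p | v p == x] is Some p then v (p.1, p.2 (+) e p.1) else x.

Lemma swap_fun_in e p : swap_fun e (v p) = v (p.1, p.2 (+) e p.1).
Proof.
rewrite /swap_fun; case: pickP => [q /eqP/v_inj ->//|/(_ p)].
by rewrite eqxx.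
Qed.

Lemma swap_fun_out e x : (forall p, v p != x) -> swap_fun e x = x.
Proof. by move=> h; rewrite /swap_fun; case: pickP => // p; rewrite (negPf (h p)). Qed.

Lemma swap_funK e : involutive (swap_fun e).
Proof.
move=> x; rewrite {2}/swap_fun; case: pickP => [[i b] /eqP <-|h].
  by rewrite swap_fun_in/= addbK.
by rewrite swap_fun_out// => p; rewrite h.
Qed.

Definition swaps e : 'S_n := perm (inv_inj (swap_funK e)).

Lemma swaps_in e i b : swaps e (v (i, b)) = v (i, b (+) e i).
Proof. by rewrite permE swap_fun_in. Qed.

Lemma swaps_out e x : (forall p, v p != x) -> swaps e x = x.
Proof. by rewrite permE; exact: swap_fun_out. Qed.

(** The image of a vertex involves at most the sign of its own pair. For an unpaired vertex the
    index is arbitrary, and [i0] is the default. *)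
Lemma swaps_coord (i0 : 'I_k) x :
  exists ig : 'I_k * (bool -> 'I_n), forall e, swaps e x = ig.2 (e ig.1).
Proof.
case: (pickP (fun p => v p == x)) => [[i b] /eqP <-|h].
  by exists (i, fun c => v (i, b (+) c)) => e; rewrite swaps_in.
by exists (i0, fun=> x) => e; rewrite swaps_out// => p; rewrite h.
Qed.

(** Each summand sees the images of two vertices, hence at most two signs. The factor [r] leaves
    room for the exchanges of another family. *)
Lemma odd_linear_inner (R : realType) (i0 : 'I_k) (w u : wdigraph R n)
    (r s : 'S_n) :
  odd_linear (fun e => inner (relabel (r * swaps e * s)%g w) u).
Proof.
have [ig igE] := fin_all_exists (swaps_coord i0).
pose c (z : 'I_n * 'I_n) := if z.1 != z.2 then w z.1 z.2 else 0.
pose F (z : 'I_n * 'I_n) (e : cube) :=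
  u (s (swaps e (r z.1))) (s (swaps e (r z.2))).
apply: (@eq_odd_linear _ _ (fun e => \sum_z c z * F z e)).
  move=> e; rewrite inner_relabel pair_big_dep/= big_mkcond/=.
  apply: eq_bigr => -[x y] _; rewrite /c /F/= !permM.
  by case: ifP; rewrite ?mul0r.
apply: odd_linear_sum => z.
apply: (@eq_odd_linear _ _ (fun e => u (s ((ig (r z.1)).2 (e (ig (r z.1)).1)))
  (s ((ig (r z.2)).2 (e (ig (r z.2)).1))))).
  by move=> e; rewrite /F !igE.
exact: (odd_linear2 _ _ (fun b b' => u (s ((ig (r z.1)).2 b))
  (s ((ig (r z.2)).2 b')))).
Qed.

End Swaps.

(** * The degree term *)

Section Degrees.
Variables (R : realType) (n : nat).
Implicit Types (w u : wdigraph R n) (a b c d x y : 'I_n).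

Lemma outdegB w a b : a != b ->
  outdeg w a - w a b = \sum_(y | (y != a) && (y != b)) w a y.
Proof. by rewrite eq_sym => ba; rewrite /outdeg (bigD1 b)//= [w _ _ + _]addrC addrK. Qed.

Lemma indegB w a b : a != b ->
  indeg w a - w b a = \sum_(y | (y != a) && (y != b)) w y a.
Proof. by rewrite eq_sym => ba; rewrite /indeg (bigD1 b)//= [w _ _ + _]addrC addrK. Qed.

Lemma outdeg_relabel w (s : 'S_n) x :
  outdeg (relabel s w) x = outdeg w (s^-1%g x).
Proof.
rewrite [RHS](reindex_inj (@perm_inj _ s^-1%g))/=.
by apply: eq_bigl => y; rewrite (inj_eq perm_inj).
Qed.

Lemma indeg_relabel w (s : 'S_n) x :
  indeg (relabel s w) x = indeg w (s^-1%g x).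
Proof.
rewrite [RHS](reindex_inj (@perm_inj _ s^-1%g))/=.
by apply: eq_bigl => y; rewrite (inj_eq perm_inj).
Qed.

(* Conditionally on [s a = c] and [s b = d], this is the mean decrease of
   [inner (relabel s w) u] when the images of [a] and [b] are exchanged. *)
Definition pair_disc w u a b c d : R :=
  (w a b - w b a) * (u c d - u d c) +
  ((outdeg w a - w a b - (outdeg w b - w b a)) *
   (outdeg u c - u c d - (outdeg u d - u d c)) +
   (indeg w a - w b a - (indeg w b - w a b)) *
   (indeg u c - u d c - (indeg u d - u c d))) / (n%:R - 2).

Lemma pair_disc_relabel w u (s : 'S_n) a b c d :
  pair_disc (relabel s w) u a b c d =
  pair_disc w u (s^-1%g a) (s^-1%g b) c d.
Proof. by rewrite /pair_disc !outdeg_relabel !indeg_relabel. Qed.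

Lemma pair_disc_antisym w u a b c d :
  pair_disc w u a b d c = - pair_disc w u a b c d.
Proof. by rewrite /pair_disc; ring. Qed.

(** Let [e x y] be the mean of [u (s x) (s y)] weighted by the test function. Exchanging [a] and [b]
    negates it, so it vanishes when [x] and [y] both avoid [a] and [b]. Permuting the other vertices
    shows that [e a y] and [e y a] are constant in [y] outside [a], [b]. *)
Lemma mean_pair_test w u a b (th : 'I_n -> 'I_n -> R) : a != b -> (2 < n)%N ->
  (forall c d, th d c = - th c d) ->
  mean (fun s : 'S_n => th (s a) (s b) * inner (relabel s w) u) =
  2^-1 * mean (fun s : 'S_n => th (s a) (s b) * pair_disc w u a b (s a) (s b)).
Proof.
move=> ab n2 thN.
pose E (g : 'S_n -> R) := mean (fun s : 'S_n => th (s a) (s b) * g s).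
have EZ (c : R) g : E (fun s => c * g s) = c * E g.
  by rewrite /E -unif_meanZ; apply: eq_unif_mean => s _; rewrite mulrCA.
have EB g h : E (fun s => g s - h s) = E g - E h.
  by rewrite /E -unif_meanB; apply: eq_unif_mean => s _; rewrite mulrBr.
have ED g h : E (fun s => g s + h s) = E g + E h.
  by rewrite /E -unif_meanD; apply: eq_unif_mean => s _; rewrite mulrDr.
have Esum (P : pred 'I_n) (g : 'I_n -> 'S_n -> R) :
    E (fun s => \sum_(x | P x) g x s) = \sum_(x | P x) E (g x).
  under [RHS]eq_bigr do rewrite /E.
  rewrite [RHS]big_mkcond/=.
  have -> : \sum_x (if P x then E (g x) else 0) = \sum_x E (fun s => (P x)%:R * g x s).
    by apply: eq_bigr => x _; rewrite EZ; case: (P x); rewrite ?mul1r ?mul0r.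
  rewrite -unif_mean_sum; apply: eq_unif_mean => s _.
  rewrite -mulr_sumr big_mkcond/=; congr (_ * _).
  by apply: eq_bigr => x _; case: (P x); rewrite ?mul1r ?mul0r.
have Eswap (g : 'I_n -> 'I_n -> R) :
    E (fun s => g (s b) (s a)) = - E (fun s => g (s a) (s b)).
  rewrite -mulN1r -EZ -[LHS](mean_mulgl (tperm a b)).
  apply: eq_unif_mean => s _; rewrite !permM tpermL tpermR thN.
  by rewrite !mulN1r mulrN mulNr.
pose e x y := E (fun s => u (s x) (s y)).
have e_ab x y : e (tperm a b x) (tperm a b y) = - e x y.
  rewrite -mulN1r -EZ -[LHS](mean_mulgl (tperm a b)).
  apply: eq_unif_mean => s _; rewrite !permM tpermL tpermR !tpermK thN.
  by rewrite !mulN1r mulrN mulNr.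
have e_fix (r : 'S_n) x y : r a = a -> r b = b -> e (r x) (r y) = e x y.
  move=> ra rb; rewrite -[RHS](mean_mulgl r).
  by apply: eq_unif_mean => s _; rewrite !permM ra rb.
have off x : (x != a) && (x != b) -> tperm a b x = x.
  by case/andP=> xa xb; rewrite tpermD// eq_sym.
have e0 x y : (x != a) && (x != b) -> (y != a) && (y != b) -> e x y = 0.
  by move=> /off hx /off hy; have := e_ab x y; rewrite hx hy => ?; lra.
have eba : e b a = - e a b by rewrite -e_ab tpermL tpermR.
have eby y : (y != a) && (y != b) -> e b y = - e a y.
  by move=> /off hy; rewrite -e_ab tpermL hy.
have eyb y : (y != a) && (y != b) -> e y b = - e y a.
  by move=> /off hy; rewrite -e_ab tpermL hy.
(* [X] and [Y] are the constant values of [e a y] and [e y a], written as averages over the n - 2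
   vertices [y] other than [a] and [b]. *)
pose X := E (fun s => outdeg u (s a) - u (s a) (s b)) / (n%:R - 2).
pose Y := E (fun s => indeg u (s a) - u (s b) (s a)) / (n%:R - 2).
have n20 : n%:R - 2 != 0 :> R.
  by rewrite subr_eq0 eqr_nat; case: eqP n2 => // ->.
have cardab : \sum_(y | (y != a) && (y != b)) 1 = n%:R - 2 :> R.
  have : \sum_(y : 'I_n) 1 = n%:R :> R by rewrite sumr_const card_ord.
  by rewrite (bigD1 a)//= (bigD1 b)/= 1?eq_sym// => <-; ring.
have const g y :
    (forall z, (z != a) && (z != b) -> g z = g y :> R) ->
    \sum_(z | (z != a) && (z != b)) g z = (n%:R - 2) * g y.
  move=> gE; rewrite -cardab mulr_suml; apply: eq_bigr => z zab.
  by rewrite mul1r gE.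
have tfix y z : (y != a) && (y != b) -> (z != a) && (z != b) ->
    tperm y z a = a /\ tperm y z b = b.
  by move=> /andP[ya yb] /andP[za zb]; rewrite !tpermD.
have eay y : (y != a) && (y != b) -> e a y = X.
  move=> yab; apply: (mulfI n20); rewrite /X [RHS]mulrCA mulfV// mulr1.
  rewrite -const => [|z zab]; last first.
    have [ha hb] := tfix y z yab zab.
    by rewrite -(e_fix _ _ _ ha hb) ha tpermR.
  rewrite -Esum; apply: eq_unif_mean => s _; congr (_ * _).
  rewrite outdegB ?(inj_eq perm_inj)//.
  rewrite [RHS](reindex_inj (@perm_inj _ s))/=.
  by apply: eq_bigl => z; rewrite !(inj_eq perm_inj).
have eya y : (y != a) && (y != b) -> e y a = Y.
  move=> yab; apply: (mulfI n20); rewrite /Y [RHS]mulrCA mulfV// mulr1.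
  rewrite -(const (fun z => e z a)) => [|z zab]; last first.
    have [ha hb] := tfix y z yab zab.
    by rewrite -(e_fix _ _ _ ha hb) ha tpermR.
  rewrite -Esum; apply: eq_unif_mean => s _; congr (_ * _).
  rewrite indegB ?(inj_eq perm_inj)//.
  rewrite [RHS](reindex_inj (@perm_inj _ s))/=.
  by apply: eq_bigl => z; rewrite !(inj_eq perm_inj).
have -> : mean (fun s : 'S_n => th (s a) (s b) * inner (relabel s w) u) =
    \sum_x \sum_(y | x != y) w x y * e x y.
  under eq_unif_mean do rewrite inner_relabel.
  rewrite -/(E _) Esum; apply: eq_bigr => x _.
  by rewrite Esum; apply: eq_bigr => y _; rewrite EZ.
have -> : \sum_x \sum_(y | x != y) w x y * e x y =
    (w a b - w b a) * e a b +
    (outdeg w a - w a b - (outdeg w b - w b a)) * X +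
    (indeg w a - w b a - (indeg w b - w a b)) * Y.
  have ba : b != a by rewrite eq_sym.
  rewrite (bigD1 a)//= (bigD1 b)//=.
  rewrite [X in _ + X](bigD1 b)//= [X in _ + (X + _)](bigD1 a)//=.
  rewrite eba !outdegB// !indegB//.
  have -> : \sum_(y | (a != y) && (y != b)) w a y * e a y =
      (\sum_(y | (y != a) && (y != b)) w a y) * X.
    rewrite mulr_suml; apply: eq_big => [y|y]; rewrite (eq_sym a)// => yab.
    by rewrite eay.
  have -> : \sum_(y | (b != y) && (y != a)) w b y * e b y =
      - (\sum_(y | (y != b) && (y != a)) w b y) * X.
    rewrite mulNr mulr_suml -sumrN.
    apply: eq_big => [y|y]; rewrite (eq_sym b)// => yab.
    by rewrite eby 1?andbC// mulrN eay// andbC.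
  have -> : \sum_(x | (x != a) && (x != b)) \sum_(y | x != y) w x y * e x y =
      (\sum_(x | (x != a) && (x != b)) w x a -
       \sum_(x | (x != b) && (x != a)) w x b) * Y.
    under [X in _ - X]eq_bigl do rewrite andbC.
    rewrite -sumrB mulr_suml; apply: eq_bigr => x xab.
    have /andP[xa xb] := xab.
    rewrite (bigD1 a)//= (bigD1 b)/=; last by rewrite xb.
    rewrite big1 ?addr0 => [|y /andP[/andP[xy ya] yb]]; last first.
      by rewrite e0 ?mulr0// ya.
    by rewrite eyb// eya//; ring.
  by ring.
(* Against an antisymmetric test function both halves of a difference count equally, whence the
   factor 1/2 in the conclusion. *)
have anti (g : 'I_n -> 'I_n -> R) :
    E (fun s => g (s a) (s b) - g (s b) (s a)) = 2 * E (fun s => g (s a) (s b)).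
  by rewrite EB (Eswap g); ring.
have -> : mean (fun s : 'S_n => th (s a) (s b) * pair_disc w u a b (s a) (s b)) =
  (w a b - w b a) * E (fun s => u (s a) (s b) - u (s b) (s a)) +
  (outdeg w a - w a b - (outdeg w b - w b a)) / (n%:R - 2) *
    E (fun s => outdeg u (s a) - u (s a) (s b) - (outdeg u (s b) - u (s b) (s a))) +
  (indeg w a - w b a - (indeg w b - w a b)) / (n%:R - 2) *
    E (fun s => indeg u (s a) - u (s b) (s a) - (indeg u (s b) - u (s a) (s b))).
  rewrite -!EZ -!ED; apply: eq_unif_mean => s _; congr (_ * _).
  by rewrite /pair_disc; ring.
rewrite (anti u) (anti (fun c d => outdeg u c - u c d)).
rewrite (anti (fun c d => indeg u c - u d c)) /X /Y /e.
by field.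
Qed.

(** The skew part of [w] with its gradient component, of potential [2 * qdeg], removed. *)
Definition skew_res w a b : R := w a b - w b a - 2 * (qdeg w a - qdeg w b).

(** Since the q_b sum to zero, the gradient terms 2 (q_a - q_b) sum over b to 2n q_a, which is r_a -
    c_a. *)
Lemma sum_skew_res w a : (0 < n)%N -> \sum_(b | b != a) skew_res w a b = 0.
Proof.
move=> n0; have nn0 : n%:R != 0 :> R by rewrite pnatr_eq0 -lt0n.
have sumq : \sum_x qdeg w x = 0.
  rewrite /qdeg -mulr_suml sumrB [X in X - _](exchange_big_dep predT)//=.
  rewrite (_ : _ - _ = 0) ?mul0r//; apply/eqP; rewrite subr_eq0; apply/eqP.
  by apply: eq_bigr => x _; apply: eq_bigl => y; rewrite eq_sym.
rewrite /skew_res !sumrB -/(outdeg w a) -/(indeg w a) -mulr_sumr sumrB.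
have -> : \sum_(b | b != a) qdeg w b = - qdeg w a.
  by move: sumq; rewrite (bigD1 a)//=; lra.
have -> : \sum_(b : 'I_n | b != a) qdeg w a = (n%:R - 1) * qdeg w a.
  have : \sum_(b : 'I_n) qdeg w a = n%:R * qdeg w a.
    by rewrite sumr_const card_ord mulr_natl.
  by rewrite (bigD1 a)//=; lra.
by rewrite /qdeg; field.
Qed.

(** The weights in [Phi1] are what this identity calls for: each square root meets itself in the
    inner product, and a rational identity remains. *)
Lemma pair_disc_Phi1 w u a b c d : (2 < n)%N ->
  pair_disc w u a b c d = n%:R * dot2 (Phi1 w (a, b)) (Phi1 u (c, d)) +
    n%:R / (n%:R - 2) * skew_res w a b * skew_res u c d.
Proof.
move=> n2; have nR : 2 < n%:R :> R by rewrite ltr_nat.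
rewrite /dot2 /Phi1/= mulrACA -expr2 sqr_sqrtr; last first.
  by rewrite divr_ge0 ?mulr_ge0//; lra.
rewrite [X in _ * (_ + X)]mulrACA -expr2 sqr_sqrtr//.
rewrite /pair_disc /skew_res /pdeg /qdeg.
by field; apply/andP; split; apply: lt0r_neq0; lra.
Qed.

Lemma sum_distinct_pairs (f : 'I_n * 'I_n -> R) :
  \sum_(e in distinct_pairs n) f e = \sum_a \sum_(b | b != a) f (a, b).
Proof.
rewrite pair_big_dep/=; apply: eq_big => [[a b]|[a b] _]//.
by rewrite inE/= eq_sym.
Qed.

(* Averaging over [b] annihilates [r] and turns [h a - h b] into the deviation
   of [h a] from its mean. *)
Lemma sum_diff_le (h : 'I_n -> R) (r : 'I_n -> 'I_n -> R) : (0 < n)%N ->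
  (forall a, \sum_(b | b != a) r a b = 0) ->
  n%:R * \sum_a \sum_(b | b != a) `|h a - h b| <=
  2 * \sum_a \sum_(b | b != a) `|n%:R * (h a - h b) + r a b|.
Proof.
move=> n0 r0; have nR : 0 < n%:R :> R by rewrite ltr0n.
pose m := (\sum_x h x) / n%:R.
pose G a := \sum_(b | b != a) `|n%:R * (h a - h b) + r a b|.
have G0 a : 0 <= G a by apply: sumr_ge0.
have hG a : n%:R ^+ 2 * `|h a - m| <= G a.
  apply: le_trans (ler_norm_sum _ _ _).
  rewrite big_split/= r0 addr0 -mulr_sumr.
  have -> : \sum_(b | b != a) (h a - h b) = n%:R * (h a - m).
    transitivity (\sum_b (h a - h b)).
      by rewrite [RHS](bigD1 a)//= subrr add0r.
    rewrite sumrB sumr_const card_ord /m -[h a *+ n]mulr_natl.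
    by field; exact: lt0r_neq0.
  by rewrite mulrA -expr2 normrM ger0_norm// exprn_ge0// ltW.
have hab a b : n%:R * `|h a - h b| <= n%:R^-1 * (G a + G b).
  rewrite -(ler_pM2l nR) [leRHS]mulrA mulfV ?lt0r_neq0// mul1r mulrA -expr2.
  apply: le_trans (lerD (hG a) (hG b)); rewrite -mulrDr ler_wpM2l ?exprn_ge0 ?ler0n//.
  rewrite (_ : h a - h b = (h a - m) - (h b - m)); last ring.
  exact: ler_normB.
rewrite mulr_sumr; under eq_bigr do rewrite mulr_sumr.
apply: (@le_trans _ _ (\sum_a \sum_b n%:R^-1 * (G a + G b))).
  apply: ler_sum => a _; rewrite [leRHS](bigD1 a)//=.
  apply: ler_wpDl; first by rewrite mulr_ge0 ?addr_ge0// invr_ge0 ltW.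
  by apply: ler_sum => b _; exact: hab.
under eq_bigr do rewrite -mulr_sumr big_split/= sumr_const card_ord.
rewrite -mulr_sumr big_split/= sumr_const card_ord sumrMnl.
rewrite -mulrnDl -[(_ + _) *+ n]mulr_natr mulrC mulfK ?lt0r_neq0//.
by rewrite -mulr2n mulr_natl.
Qed.

(** For fixed (c, d) the inner product with [Phi1 u (c, d)] is a difference h(a) - h(b), and the
    residual sums to zero over b, so [sum_diff_le] applies. *)
Lemma J1_pair_disc w u : (2 < n)%N ->
  n%:R * J1 w u <= 2 * unif_mean (distinct_pairs n) (fun e =>
    unif_mean (distinct_pairs n) (fun e' => `|pair_disc w u e.1 e.2 e'.1 e'.2|)).
Proof.
move=> n2; have n0 : (0 < n)%N by exact: leq_trans n2.
rewrite /J1 unif_mean_setX unif_mean_exchange -unif_meanZ.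
rewrite [X in _ * X]unif_mean_exchange -[leRHS]unif_meanZ.
apply: ler_unif_mean => -[c d] _; rewrite /unif_mean !mulrA.
rewrite ler_wpM2r ?invr_ge0 ?ler0n// !sum_distinct_pairs/=.
set q := Phi1 u _.
pose h x := Num.sqrt (2 * (n%:R - 2) / n%:R) * pdeg w x * q.1 +
  Num.sqrt 2 * qdeg w x * q.2.
have hE a b : dot2 (Phi1 w (a, b)) q = h a - h b.
  by rewrite /dot2 /h /Phi1/=; ring.
under eq_bigr do under eq_bigr do rewrite hE.
under [X in _ <= 2 * X]eq_bigr do under eq_bigr do rewrite pair_disc_Phi1// -/q hE.
apply: sum_diff_le => // a.
by rewrite -mulr_suml -mulr_sumr sum_skew_res// mulr0 mul0r.
Qed.

End Degrees.

(** * The quadruple term *)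

Section Quads.
Variables (R : realType) (n : nat).
Implicit Types (w u : wdigraph R n) (a b c d x y : 'I_n).

(** [Phi2] is an orthogonal map, scaled by 2^(-1/2), of the vector with entries [Cw w Q] and
    [Cw w (quadT Q)]. *)
Lemma dot2_Phi2 w u (Q Q' : quad n) :
  dot2 (Phi2 w Q) (Phi2 u Q') =
  2^-1 * (Cw w Q * Cw u Q' + Cw w (quadT Q) * Cw u (quadT Q')).
Proof. by rewrite /dot2 /Phi2/=; field. Qed.

Lemma big_two (F : 'I_n -> R) a b : a != b ->
  (forall x, x != a -> x != b -> F x = 0) -> \sum_x F x = F a + F b.
Proof.
rewrite eq_sym => ba F0; rewrite (bigD1 a)//= (bigD1 b)//= big1 ?addr0//.
by move=> x /andP[]; exact: F0.
Qed.

(** The weighted mean [e x y] of [u (s x) (s y)] changes sign under each of the transpositions (a b)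
    and (c d). It therefore vanishes unless one of [x], [y] is in {a, b} and the other in {c, d}. *)
Lemma mean_quad_test w u a b c d (th : 'I_n -> 'I_n -> 'I_n -> 'I_n -> R) :
  uniq [:: a; b; c; d] ->
  (forall x y z t, th y x z t = - th x y z t) ->
  (forall x y z t, th x y t z = - th x y z t) ->
  mean (fun s : 'S_n => th (s a) (s b) (s c) (s d) * inner (relabel s w) u) =
  2^-1 * mean (fun s : 'S_n => th (s a) (s b) (s c) (s d) *
    dot2 (Phi2 w ((a, b), (c, d))) (Phi2 u ((s a, s b), (s c, s d)))).
Proof.
rewrite /= !inE !negb_or -!andbA => /and5P[ab ac ad bc /and3P[bd cd _]] th1 th2.
pose E (g : 'S_n -> R) :=
  mean (fun s : 'S_n => th (s a) (s b) (s c) (s d) * g s).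
have EZ (k : R) g : E (fun s => k * g s) = k * E g.
  by rewrite /E -unif_meanZ; apply: eq_unif_mean => s _; rewrite mulrCA.
have EB g h : E (fun s => g s - h s) = E g - E h.
  by rewrite /E -unif_meanB; apply: eq_unif_mean => s _; rewrite mulrBr.
have ED g h : E (fun s => g s + h s) = E g + E h.
  by rewrite /E -unif_meanD; apply: eq_unif_mean => s _; rewrite mulrDr.
have Esum (g : 'I_n -> 'S_n -> R) :
    E (fun s => \sum_x g x s) = \sum_x E (g x).
  rewrite -unif_mean_sum; apply: eq_unif_mean => s _; exact: mulr_sumr.
pose e x y := E (fun s => u (s x) (s y)).
have e_ab x y : e (tperm a b x) (tperm a b y) = - e x y.
  rewrite -mulN1r -EZ -[LHS](mean_mulgl (tperm a b)).
  apply: eq_unif_mean => s _; rewrite !permM tpermL tpermR !tpermK.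
  by rewrite !(tpermD ac bc) !(tpermD ad bd) th1 !mulN1r mulrN mulNr.
have ca : c != a by rewrite eq_sym.
have cb : c != b by rewrite eq_sym.
have da : d != a by rewrite eq_sym.
have db : d != b by rewrite eq_sym.
have e_cd x y : e (tperm c d x) (tperm c d y) = - e x y.
  rewrite -mulN1r -EZ -[LHS](mean_mulgl (tperm c d)).
  apply: eq_unif_mean => s _; rewrite !permM tpermL tpermR !tpermK.
  by rewrite !(tpermD ca da) !(tpermD cb db) th2 !mulN1r mulrN mulNr.
have off a' b' x : x != a' -> x != b' -> tperm a' b' x = x.
  by move=> xa xb; rewrite tpermD// eq_sym.
have e0ab x y : x != a -> x != b -> y != a -> y != b -> e x y = 0.
  move=> xa xb ya yb; have := e_ab x y.
  by rewrite (off _ _ _ xa xb) (off _ _ _ ya yb); lra.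
have e0cd x y : x != c -> x != d -> y != c -> y != d -> e x y = 0.
  move=> xc xd yc yd; have := e_cd x y.
  by rewrite (off _ _ _ xc xd) (off _ _ _ yc yd); lra.
(* The eight surviving values are [e a c] and [e c a] up to sign, with the signs that occur in
   [Cw]. *)
have ebc : e b c = - e a c by rewrite -e_ab tpermL (tpermD ac bc).
have ead : e a d = - e a c by rewrite -e_cd tpermL (tpermD ca da).
have ebd : e b d = e a c by rewrite -[LHS]opprK -e_ab tpermR (tpermD ad bd) ead opprK.
have ecb : e c b = - e c a by rewrite -e_ab tpermL (tpermD ac bc).
have eda : e d a = - e c a by rewrite -e_cd tpermL (tpermD ca da).
have edb : e d b = e c a by rewrite -[LHS]opprK -e_ab tpermR (tpermD ad bd) eda opprK.
have row_ab x : (x == a) || (x == b) ->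
    \sum_y w x y * e x y = w x c * e x c + w x d * e x d.
  move=> xab; apply: big_two => // y yc yd; rewrite e0cd ?mulr0//.
    by case/orP: xab => /eqP->.
  by case/orP: xab => /eqP->.
have row_cd x : (x == c) || (x == d) ->
    \sum_y w x y * e x y = w x a * e x a + w x b * e x b.
  move=> xcd; apply: big_two => // y ya yb; rewrite e0ab ?mulr0//.
    by case/orP: xcd => /eqP->.
  by case/orP: xcd => /eqP->.
have row0 x : x != a -> x != b -> x != c -> x != d ->
    \sum_y w x y * e x y = 0.
  move=> xa xb xc xd; apply: big1 => y _.
  have [ya|ya] := eqVneq y a; first by rewrite e0cd ?mulr0// ya// eq_sym.
  have [yb|yb] := eqVneq y b; first by rewrite e0cd ?mulr0// yb// eq_sym.
  by rewrite e0ab ?mulr0.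
(* Hence the diagonal, absent from [inner], may be added to the sum. *)
have exx x : e x x = 0.
  have [xa|xa] := eqVneq x a; first by rewrite e0cd ?xa// eq_sym.
  have [xb|xb] := eqVneq x b; first by rewrite e0cd ?xb// eq_sym.
  by rewrite e0ab.
have -> : mean (fun s : 'S_n =>
    th (s a) (s b) (s c) (s d) * inner (relabel s w) u) =
    \sum_x \sum_y w x y * e x y.
  under eq_unif_mean do rewrite inner_relabel.
  under eq_unif_mean => s _ do under eq_bigr => x _ do rewrite big_mkcond/=.
  rewrite -/(E _) Esum; apply: eq_bigr => x _.
  rewrite Esum; apply: eq_bigr => y _.
  have [<-|xy] := eqVneq x y; last by rewrite -EZ.
  rewrite exx mulr0 -[RHS](mul0r (E (fun=> 0))) -EZ.
  by apply: eq_unif_mean => s _; rewrite mul0r.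
have -> : \sum_x \sum_y w x y * e x y =
    Cw w ((a, b), (c, d)) * e a c + Cw w ((c, d), (a, b)) * e c a.
  pose F x := \sum_y w x y * e x y.
  rewrite (eq_bigr F)// (bigD1 a)//= (bigD1 b)/=; last by rewrite eq_sym.
  rewrite (bigD1 c)/=; last by rewrite ca cb.
  rewrite (bigD1 d)/=; last by rewrite da db eq_sym.
  rewrite big1 ?addr0 => [|x /andP[/andP[/andP[xa xb] xc] xd]]; last exact: row0.
  rewrite /F !(row_ab a, row_ab b, row_cd c, row_cd d) ?eqxx ?orbT//.
  by rewrite ebc ead ebd ecb eda edb /Cw; ring.
have -> : mean (fun s : 'S_n => th (s a) (s b) (s c) (s d) *
    dot2 (Phi2 w ((a, b), (c, d))) (Phi2 u ((s a, s b), (s c, s d)))) =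
  2^-1 * (Cw w ((a, b), (c, d)) *
      E (fun s => u (s a) (s c) - u (s b) (s c) - u (s a) (s d) + u (s b) (s d))
    + Cw w ((c, d), (a, b)) *
      E (fun s => u (s c) (s a) - u (s d) (s a) - u (s c) (s b) + u (s d) (s b))).
  rewrite -!EZ -!ED -EZ; apply: eq_unif_mean => s _; congr (_ * _).
  by rewrite dot2_Phi2.
have E4 g1 g2 g3 g4 : E (fun s => g1 s - g2 s - g3 s + g4 s) =
    E g1 - E g2 - E g3 + E g4.
  by rewrite ED !EB.
rewrite !E4 -!/(e _ _).
by rewrite ebc ead ebd ecb eda edb; field.
Qed.

End Quads.

(** * Lower bounds by the density, [J1] and [J2] terms *)

Lemma normr_sg_le1 (R : realType) (x : R) : `|Num.sg x| <= 1.
Proof. by rewrite normr_sg; case: (x != 0); rewrite ?ler01. Qed.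

Section LowerBounds.
Variables (R : realType) (n k : nat) (i0 : 'I_k).
Implicit Types w u : wdigraph R n.

(** For distinct x, y the image pair is uniform, so [u (s x) (s y)] has mean [density u]; the rest
    is |E f| <= E|f|. *)
Lemma density_le w u : (1 < n)%N ->
  `|density w * density u| * (n%:R * (n%:R - 1)) <=
  mean (fun s => `|inner (relabel s w) u|).
Proof.
move=> n1; apply: le_trans (ler_norm_unif_mean _ _).
have n1R : 1 < n%:R :> R by rewrite ltr1n.
set N := n%:R * (n%:R - 1).
have N0 : 0 < N by rewrite mulr_gt0; lra.
have offdiag (f : wdigraph R n) :
    \sum_(e in distinct_pairs n) f e.1 e.2 = total_weight f.
  by rewrite /total_weight pair_big_dep/=; apply: eq_bigl => e; rewrite inE.
have cardN : #|distinct_pairs n|%:R = N.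
  rewrite -sum1_card natr_sum sum_distinct_pairs.
  have row (a : 'I_n) : \sum_(b | b != a) 1 = n%:R - 1 :> R.
    have : \sum_(b : 'I_n) 1 = n%:R :> R by rewrite sumr_const card_ord.
    by rewrite (bigD1 a)//= => <-; ring.
  by under eq_bigr do rewrite row; rewrite sumr_const card_ord -[LHS]mulr_natl.
have -> : mean (fun s => inner (relabel s w) u) = total_weight w * total_weight u / N.
  under eq_unif_mean => s _.
    rewrite inner_relabel.
    under eq_bigr do rewrite big_mkcond/=.
    over.
  rewrite unif_mean_sum -mulrA [in RHS]mulr_suml; apply: eq_bigr => x _.
  rewrite unif_mean_sum mulr_suml [RHS]big_mkcond/=; apply: eq_bigr => y _.
  have [_|xy] := eqVneq x y; first by rewrite (mean_cst (1%g : 'S_n)).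
  rewrite unif_meanZ (mean_pair u xy) /unif_mean.
  by rewrite (offdiag u) cardN.
rewrite /density -/N -[X in _ * X]gtr0_norm// -normrM.
rewrite (_ : _ / N * _ * _ = total_weight w * total_weight u / N)//.
by field; exact: lt0r_neq0.
Qed.

Lemma J1_le (v : 'I_k * bool -> 'I_n) w u : (2 < n)%N -> injective v ->
  Num.sqrt k%:R * (n%:R * J1 w u) <=
  8 * mean (fun s => `|inner (relabel s w) u|).
Proof.
move=> n2 vI; have k0 : 0 < Num.sqrt k%:R :> R.
  by rewrite sqrtr_gt0 ltr0n; case: k i0 => // -[].
pose a i := v (i, false); pose b i := v (i, true).
have ab i : a i != b i by rewrite (inj_eq vI) xpair_eqE andbF.
set M := mean _.
pose D w' (a b : 'I_n) (e : 'I_n * 'I_n) := `|pair_disc w' u a b e.1 e.2|.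
have fixed w' : \sum_i 2^-1 * unif_mean (distinct_pairs n) (D w' (a i) (b i)) <=
    2 * Num.sqrt k%:R * mean (fun s => `|inner (relabel s w') u|).
  (* Testing with the sign of [pair_disc] produces its absolute value, and antisymmetry is inherited
     from [pair_disc]. *)
  pose th i (s : 'S_n) := Num.sg (pair_disc w' u (a i) (b i) (s (a i)) (s (b i))).
  apply: le_trans (swap_test1 (T := swaps vI) (th := th) _ _ _).
  - apply: ler_sum => i _.
    rewrite (mean_pair_test w' u
      (th := fun c d => Num.sg (pair_disc w' u (a i) (b i) c d)) (ab i) n2).
      rewrite ler_pM2l ?invr_gt0//.
      rewrite -(mean_pair (fun c d => D w' (a i) (b i) (c, d)) (ab i)).
      by apply: ler_unif_mean => s _; rewrite /D/= normrEsg.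
    by move=> c d; rewrite pair_disc_antisym sgrN.
  - move=> s; have := odd_linear_inner vI i0 w' u 1%g s.
    by apply: eq_odd_linear => e; rewrite mul1g.
  - by move=> i s; exact: normr_sg_le1.
  - move=> i e s; rewrite /th !permM /a /b !swaps_in/=.
    rewrite /sign; case: (e i); rewrite ?expr0 ?mul1r// expr1.
    by rewrite pair_disc_antisym sgrN mulN1r.
(* Relabelling [w] by [s^-1] replaces the fixed pair by its image under [s] and leaves the right
   side unchanged; averaging over [s] makes the pair uniform. *)
have avg : \sum_(i < k) 2^-1 * unif_mean (distinct_pairs n) (fun e =>
    unif_mean (distinct_pairs n) (D w e.1 e.2)) <= 2 * Num.sqrt k%:R * M.
  have -> : 2 * Num.sqrt k%:R * M = mean (fun s : 'S_n => 2 * Num.sqrt k%:R *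
      mean (fun r => `|inner (relabel r (relabel s^-1%g w)) u|)).
    under eq_unif_mean do rewrite mean_inner_relabel.
    by rewrite (mean_cst (1%g : 'S_n)).
  apply: le_trans (ler_unif_mean (fun s _ => fixed (relabel s^-1%g w))).
  rewrite unif_mean_sum; apply: ler_sum => i _.
  rewrite unif_meanZ -(mean_pair (fun a b => unif_mean _ (D w a b)) (ab i)).
  rewrite le_eqVlt; apply/orP; left; apply/eqP; congr (_ * _).
  apply: eq_unif_mean => s _; apply: eq_unif_mean => e _.
  by rewrite /D pair_disc_relabel invgK.
(* With A the double mean of |[pair_disc]|, k A / 2 <= 2 sqrt(k) M and n J1 <= 2 A combine to the
   constant 8. *)
have := J1_pair_disc w u n2; move: avg; rewrite sumr_const card_ord /D.
set A := unif_mean _ _; rewrite -mulr_natl => avg J1A.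
rewrite -(ler_pM2l k0) mulrA -expr2 sqr_sqrtr ?ler0n//.
have kR : 0 <= k%:R :> R by rewrite ler0n.
by apply: le_trans (ler_wpM2l kR J1A) _; lra.
Qed.

Lemma J2_le (v1 v2 : 'I_k * bool -> 'I_n) w u :
  injective v1 -> injective v2 -> (forall p q, v1 p != v2 q) ->
  k%:R * J2 w u <= 8 * mean (fun s => `|inner (relabel s w) u|).
Proof.
move=> vI1 vI2 v12; have kp : 0 < k%:R :> R.
  by rewrite ltr0n; case: k i0 => // -[].
have v21 p q : v2 p != v1 q by rewrite eq_sym.
pose a i := v1 (i, false); pose b i := v1 (i, true).
pose c i := v2 (i, false); pose d i := v2 (i, true).
have abcd i j : uniq [:: a i; b i; c j; d j].
  by rewrite /= !inE !negb_or !v12 (inj_eq vI1) (inj_eq vI2) !xpair_eqE !andbF.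
pose D w' x y z t (Q : quad n) := dot2 (Phi2 w' ((x, y), (z, t))) (Phi2 u Q).
have DN1 w' x y z t x' y' z' t' :
    D w' x y z t ((y', x'), (z', t')) = - D w' x y z t ((x', y'), (z', t')).
  by rewrite /D !dot2_Phi2 /quadT /Cw /=; ring.
have DN2 w' x y z t x' y' z' t' :
    D w' x y z t ((x', y'), (t', z')) = - D w' x y z t ((x', y'), (z', t')).
  by rewrite /D !dot2_Phi2 /quadT /Cw /=; ring.
have fixed w' : \sum_i \sum_j 2^-1 * unif_mean (distinct_quads n)
      (fun Q => `|D w' (a i) (b i) (c j) (d j) Q|) <=
    4 * k%:R * mean (fun s => `|inner (relabel s w') u|).
  (* This sign is odd under the exchange of either pair, because both components of [Phi2 u] are. *)
  pose th0 i j x y z t := Num.sg (D w' (a i) (b i) (c j) (d j) ((x, y), (z, t))).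
  pose th i j (s : 'S_n) := th0 i j (s (a i)) (s (b i)) (s (c j)) (s (d j)).
  apply: le_trans (swap_test2 (T1 := swaps vI1) (T2 := swaps vI2) (th := th) _ _ _ _ _).
  - apply: ler_sum => i _; apply: ler_sum => j _.
    rewrite (mean_quad_test w' u (th := th0 i j) (abcd i j)).
    + rewrite ler_pM2l ?invr_gt0//.
      rewrite -(mean_quad (fun Q => `|D w' (a i) (b i) (c j) (d j) Q|) (abcd i j)).
      by apply: ler_unif_mean => s _; rewrite normrEsg.
    + by move=> x y z t; rewrite /th0 DN1 sgrN.
    + by move=> x y z t; rewrite /th0 DN2 sgrN.
  - move=> s; have := odd_linear_inner vI1 i0 w' u 1%g s.
    by apply: eq_odd_linear => e; rewrite mul1g.
  - by move=> r s; exact: (odd_linear_inner vI2 i0 w' u r s).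
  - by move=> i j s; exact: normr_sg_le1.
  - move=> i j e s; rewrite /th !permM /a /b /c /d.
    rewrite !(swaps_in vI1) !(swaps_out vI1 e (fun p => v12 p _)).
    rewrite /sign; case: (e i); rewrite ?expr0 ?mul1r// expr1.
    by rewrite /th0 DN1 sgrN mulN1r.
  - move=> i j e s; rewrite /th !permM /a /b /c /d.
    rewrite !(swaps_in vI2) !(swaps_out vI2 e (fun p => v21 p _)).
    rewrite /sign; case: (e j); rewrite ?expr0 ?mul1r// expr1.
    by rewrite /th0 DN2 sgrN mulN1r.
set M := mean _.
have avg : \sum_(i < k) \sum_(j < k) 2^-1 * J2 w u <= 4 * k%:R * M.
  have -> : 4 * k%:R * M = mean (fun s : 'S_n => 4 * k%:R *
      mean (fun r => `|inner (relabel r (relabel s^-1%g w)) u|)).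
    under eq_unif_mean do rewrite mean_inner_relabel.
    by rewrite (mean_cst (1%g : 'S_n)).
  apply: le_trans (ler_unif_mean (fun s _ => fixed (relabel s^-1%g w))).
  rewrite unif_mean_sum; apply: ler_sum => i _.
  rewrite unif_mean_sum; apply: ler_sum => j _.
  rewrite unif_meanZ /J2 unif_mean_setX.
  rewrite -(mean_quad (fun Q => unif_mean (distinct_quads n)
    (fun Q' => `|dot2 (Phi2 w Q) (Phi2 u Q')|)) (abcd i j)).
  rewrite le_eqVlt; apply/orP; left; apply/eqP; congr (_ * _).
  apply: eq_unif_mean => s _; apply: eq_unif_mean => Q _.
  by congr (`|_|); rewrite /D /Phi2 /Cw /relabel/= invgK.
(* There are k^2 equal summands J2 / 2 against 4 k M, so k J2 <= 8 M. *)
move: avg; rewrite !sumr_const card_ord -mulrnA -[_ *+ (k * k)]mulr_natl natrM => avg.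
by rewrite -(ler_pM2l kp); lra.
Qed.

End LowerBounds.

(** * Choice of the pairs and assembly of the constants *)

Lemma disjoint_pairs (n : nat) : exists v1 v2 : 'I_(n %/ 4) * bool -> 'I_n,
  [/\ injective v1, injective v2 & forall p q, v1 p != v2 q].
Proof.
have le4 : (#|{: 'I_(n %/ 4) * bool * bool}| <= n)%N.
  by rewrite !card_prod card_ord card_bool; lia.
pose V p := widen_ord le4 (enum_rank p).
have VI : injective V by move=> p q /(congr1 val)/= /val_inj/enum_rank_inj.
exists (fun p => V (p, false)), (fun p => V (p, true)); split.
- by move=> p q /VI[].
- by move=> p q /VI[].
- by move=> p q; rewrite (inj_eq VI) xpair_eqE andbF.
Qed.

Theorem theorem1p8 (R : realType) :
  exists c : R, 0 < c /\
    forall (n : nat) (w u : wdigraph R n), (4 <= n)%N ->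
      unif_mean [set: 'S_n] (fun s => `|inner (relabel s w) u|) >=
      c * (`|density w * density u| * (n%:R * (n%:R - 1))
           + n%:R `^ (3 / 2) * J1 w u
           + n%:R * J2 w u).
Proof.
(* The three terms are at most M, 24 M and 56 M, in total 81 M. *)
exists 100^-1; split=> [|n w u n4]; first by rewrite invr_gt0.
set M := unif_mean _ _.
have [v1 [v2 [vI1 vI2 v12]]] := disjoint_pairs n.
have k0 : (0 < n %/ 4)%N by lia.
have n2 : (2 < n)%N by lia.
have n1 : (1 < n)%N by lia.
have h0 := density_le w u n1; rewrite -/M in h0.
have h1 := J1_le (Ordinal k0) w u n2 vI1; rewrite -/M in h1.
have h2 := J2_le (Ordinal k0) w u vI1 vI2 v12; rewrite -/M in h2.
have M0 : 0 <= M.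
  by rewrite mulr_ge0 ?invr_ge0 ?ler0n//; apply: sumr_ge0.
have J1ge : 0 <= J1 w u.
  by rewrite mulr_ge0 ?invr_ge0 ?ler0n//; apply: sumr_ge0.
have J2ge : 0 <= J2 w u.
  by rewrite mulr_ge0 ?invr_ge0 ?ler0n//; apply: sumr_ge0.
(* The extreme case is n = 7. Since 7 <= 9, the square roots differ by a factor of at most 3. *)
have nk : n%:R <= 7 * (n %/ 4)%:R :> R by rewrite -natrM ler_nat; lia.
have snk : Num.sqrt n%:R <= 3 * Num.sqrt (n %/ 4)%:R :> R.
  rewrite -[3](@ger0_norm R)// -sqrtr_sqr -sqrtrM ?sqr_ge0// ler_wsqrtr//.
  by have : 0 <= (n %/ 4)%:R :> R; [rewrite ler0n|lra].
have -> : n%:R `^ (3 / 2) = n%:R * Num.sqrt n%:R :> R.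
  rewrite (_ : 3 / 2 = 1 + 2^-1); last by field.
  rewrite powRD; last by rewrite pnatr_eq0; apply/implyP => _; lia.
  by rewrite powRr1 ?ler0n// powR12_sqrt ?ler0n.
have e1 : n%:R * Num.sqrt n%:R * J1 w u <= 24 * M.
  have : Num.sqrt n%:R * (n%:R * J1 w u) <=
      3 * Num.sqrt (n %/ 4)%:R * (n%:R * J1 w u).
    by rewrite ler_wpM2r// mulr_ge0.
  by rewrite -(mulrA 3); lra.
have e2 : n%:R * J2 w u <= 56 * M.
  by have := ler_wpM2r J2ge nk; rewrite -(mulrA 7); lra.
rewrite mulrC ler_pdivrMr//; lra.
Qed.
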